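(* Let $n>5$ and let $S\in\mathcal D_n^s$ be such that both of its directed cycles have odd length. Then: (i) if $n$ is even, the maximal energy among such $S$ is attained by $S\cong D_n^s[3,n-3]$; (ii) if $n$ is odd, the maximal energy among such $S$ is attained by $S\cong D_n^s[3,n-4]$; (iii) the minimal energy among such $S$ is attained by $S\cong D_n^s[3,3]$.
   Context: A signed digraph (sidigraph) is a digraph in which every arc carries a sign $+1$ or $-1$; the energy of a sidigraph is the sum of the absolute values of the real parts of the eigenvalues of its signed adjacency matrix. The sign of a directed cycle is the product of the signs of its arcs; $C_k$ denotes a positive directed cycle of length $k$. It is known that for odd $k$ every directed cycle of length $k$ (positive or negative) has energy $\csc\frac{\pi}{2k}$. $\mathcal D_n^s$ is the class of sidigraphs on $n$ vertices whose underlying graph is connected and which contain exactly two directed cycles, these two cycles being vertex-disjoint. The energy of $S\in\mathcal D_n^s$ equals the sum of the energies of its two directed cycles. For integers $p,q\ge 2$ with $p+q\le n$, $D_n^s[p,q]$ denotes a member of $\mathcal D_n^s$ whose two directed cycles are $C_p$ and $C_q$. *)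

(* Defs.v *)
From HB Require Import structures.
From mathcomp Require Import all_boot all_order all_algebra.
From mathcomp Require Import algC.
Set Implicit Arguments. Unset Strict Implicit. Unset Printing Implicit Defensive.
Import Order.TTheory GRing.Theory Num.Theory.
Local Open Scope ring_scope.

(* A sidigraph on n vertices ('I_n) is given by its signed adjacency matrix:
   entry A i j is +1 / -1 if there is an arc i -> j with that sign, 0 otherwise.
   No loops. *)
Definition sidigraph (n : nat) (A : 'M[int]_n) : Prop :=
  (forall i j, A i j \in [:: -1; 0; 1]) /\ (forall i, A i i = 0).

Definition arc (n : nat) (A : 'M[int]_n) (i j : 'I_n) : bool := A i j != 0.

(* A directed cycle, viewed as its set of arcs: it comes from a sequence of
   k >= 2 distinct vertices v_1, ..., v_k with arcs v_1->v_2, ..., v_k->v_1. *)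
Definition is_dcycle (n : nat) (A : 'M[int]_n) (C : {set 'I_n * 'I_n}) : Prop :=
  exists c : seq 'I_n,
    [/\ uniq c, (2 <= size c)%N,
        all (fun e => arc A e.1 e.2) (zip c (rot 1 c)) &
        C = [set e in zip c (rot 1 c)]].

Definition cycle_len (n : nat) (C : {set 'I_n * 'I_n}) : nat := #|C|.
Definition cycle_verts (n : nat) (C : {set 'I_n * 'I_n}) : {set 'I_n} :=
  [set e.1 | e in C].
Definition cycle_sign (n : nat) (A : 'M[int]_n) (C : {set 'I_n * 'I_n}) : int :=
  \prod_(e in C) A e.1 e.2.

Definition underlying_connected (n : nat) (A : 'M[int]_n) : Prop :=
  forall i j : 'I_n, connect [rel x y | arc A x y || arc A y x] i j.

Definition two_cycles (n : nat) (A : 'M[int]_n) (p q : nat) : Prop :=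
  sidigraph A /\ underlying_connected A /\
  exists C1 C2 : {set 'I_n * 'I_n},
    [/\ is_dcycle A C1, is_dcycle A C2,
        [disjoint cycle_verts C1 & cycle_verts C2],
        (forall C, is_dcycle A C -> C = C1 \/ C = C2) &
        cycle_len C1 = p /\ cycle_len C2 = q].

Definition in_Dns (n : nat) (A : 'M[int]_n) : Prop :=
  exists p q, two_cycles A p q.

Definition is_Dnpq (n : nat) (A : 'M[int]_n) (p q : nat) : Prop :=
  sidigraph A /\ underlying_connected A /\
  exists C1 C2 : {set 'I_n * 'I_n},
    [/\ is_dcycle A C1, is_dcycle A C2,
        [disjoint cycle_verts C1 & cycle_verts C2],
        (forall C, is_dcycle A C -> C = C1 \/ C = C2) &
        [/\ cycle_len C1 = p, cycle_len C2 = q,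
            cycle_sign A C1 = 1 & cycle_sign A C2 = 1]].

Definition odd_Dns (n : nat) (A : 'M[int]_n) : Prop :=
  exists p q, [/\ two_cycles A p q, odd p & odd q].

Definition eigenvalues (n : nat) (A : 'M[int]_n) : seq algC :=
  projT1 (closed_field_poly_normal (char_poly (map_mx (fun z : int => z%:~R : algC) A))).

Definition energy (n : nat) (A : 'M[int]_n) : algC :=
  \sum_(z <- eigenvalues A) `|'Re z|.

(* Main.v *)
(* The permutations contributing to the Leibniz expansion of the characteristic
   polynomial are products of directed cycles, so for disjoint cycles of odd lengths
   p and q with signs e1 and e2 it equals X^(n-p-q) (X^p - e1) (X^q - e2).  The roots
   of X^p - e for odd p are e w^j, j < p, with w = - exp(i pi / p), whence the sum of
   their absolute real parts is the telescoping sum of |cos(j pi / p)|, which is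
   csc(pi / (2p)).  The function x |-> csc(pi / (2x)) is increasing and convex on
   [1, +oo[: with t = pi / (2x) its derivative is proportional to t^2 cos t / sin^2 t,
   which decreases in t because 2 sin t cos t <= t (1 + cos^2 t).  Convexity gives
   csc(pi/2p) + csc(pi/2q) <= csc(pi/6) + csc(pi/2(p+q-3)) for p, q >= 3.
   These inequalities hold in the real numbers; they are pulled back to algC along
   the embedding sending a real algebraic number to its Dedekind cut.  The extremal
   digraphs exist: take the path 0 -> 1 -> ... -> n-1 together with the two back arcs
   p-1 -> 0 and p+q-1 -> p. *)

From Stdlib Require Import Reals Lra.
From Coquelicot Require Import Coquelicot.
Local Open Scope R_scope.

(** * Convexity of the cosecant *)

Lemma le_of_derive_ge0 f df a b : a <= b ->
  (forall x, a <= x <= b -> is_derive f x (df x) /\ 0 <= df x) -> f a <= f b.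
Proof.
intros [lab | <-] Hf; [| lra].
destruct (MVT_cor2 f df a b lab) as [c [E Hc]].
- intros x Hx; apply is_derive_Reals, Hf, Hx.
- assert (0 <= df c) by (apply Hf; lra); nra.
Qed.

Lemma mul_cos_le_sin t : 0 <= t <= PI / 2 -> t * cos t <= sin t.
Proof.
intros Ht.
assert (H : sin 0 - 0 * cos 0 <= sin t - t * cos t); [| rewrite sin_0 in H; lra].
apply (le_of_derive_ge0 (fun x => sin x - x * cos x) (fun x => x * sin x)); [lra |].
intros x Hx; split.
- auto_derive; [easy | ring].
- apply Rmult_le_pos; [lra | apply sin_ge_0; lra].
Qed.

(** Both sides vanish at 0, and their difference has derivative
    [sin x * (3 * sin x - 2 * x * cos x)], which is nonnegative because [x * cos x <= sin x]. This
    is the inequality behind the convexity of [cosec]. *)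
Lemma two_sin_cos_le t : 0 <= t <= PI / 2 ->
  2 * sin t * cos t <= t * (1 + cos t ^ 2).
Proof.
intros Ht.
assert (H : 0 * (1 + cos 0 ^ 2) - 2 * sin 0 * cos 0
            <= t * (1 + cos t ^ 2) - 2 * sin t * cos t);
  [| rewrite sin_0 in H; lra].
apply (le_of_derive_ge0 (fun x => x * (1 + cos x ^ 2) - 2 * sin x * cos x)
  (fun x => sin x * (3 * sin x - 2 * x * cos x))); [lra |].
intros x Hx; split.
- auto_derive; [easy |].
  assert (H := sin2_cos2 x); unfold Rsqr in H; nra.
- assert (H := mul_cos_le_sin x ltac:(lra)).
  assert (0 <= sin x) by (apply sin_ge_0; lra).
  apply Rmult_le_pos; lra.
Qed.

Lemma cos_le0 x : PI / 2 <= x -> x <= PI -> cos x <= 0.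
Proof. intros; apply cos_le_0; assert (H' := PI_RGT_0); lra. Qed.

Definition cosec x := / sin (PI / 2 / x).
Definition dcosec x := PI / 2 / x ^ 2 * cos (PI / 2 / x) / sin (PI / 2 / x) ^ 2.
(** The second derivative, arranged so that its only factor of unclear sign is the one bounded by
    [two_sin_cos_le]. *)
Definition ddcosec x := let t := PI / 2 / x in
  t * (t * (1 + cos t ^ 2) - 2 * sin t * cos t) / (x ^ 2 * sin t ^ 3).

Lemma angle_bounds x : 1 <= x -> 0 < PI / 2 / x <= PI / 2.
Proof.
intros Hx; assert (H := PI_RGT_0); split.
- apply Rdiv_lt_0_compat; lra.
- apply Rle_div_l; nra.
Qed.

Lemma sin_angle_gt0 x : 1 <= x -> 0 < sin (PI / 2 / x).
Proof. intros Hx; assert (H := angle_bounds x Hx); apply sin_gt_0; lra. Qed.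

Lemma is_derive_cosec x : 1 <= x -> is_derive cosec x (dcosec x).
Proof.
intros Hx; assert (H := sin_angle_gt0 x Hx).
unfold cosec, dcosec; auto_derive; unfold Rdiv in *; rewrite ?Rmult_1_r, ?Rmult_1_l in *.
{ repeat split; lra. }
field; split; lra.
Qed.

Lemma dcosec_ge0 x : 1 <= x -> 0 <= dcosec x.
Proof.
intros Hx; assert (H := sin_angle_gt0 x Hx); assert (Ht := angle_bounds x Hx).
unfold dcosec.
assert (0 <= cos (PI / 2 / x)) by (apply cos_ge_0; lra).
apply Rmult_le_pos.
- apply Rmult_le_pos; [apply Rdiv_le_0_compat; nra | lra].
- apply Rlt_le, Rinv_0_lt_compat, pow_lt; lra.
Qed.

Lemma is_derive_dcosec x : 1 <= x -> is_derive dcosec x (ddcosec x).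
Proof.
intros Hx; assert (H := sin_angle_gt0 x Hx).
unfold dcosec, ddcosec; auto_derive; unfold Rdiv in *; rewrite ?Rmult_1_r, ?Rmult_1_l in *.
- repeat split; try lra; nra.
- assert (E := sin2_cos2 (PI * / 2 * / x)); unfold Rsqr in E.
  set (s := sin _) in *; set (c := cos _) in *.
  (* Removing the constant 1 by Pythagoras turns the goal into a rational identity in independent
     [s] and [c]. *)
  replace (1 + c ^ 2) with (s * s + 2 * (c * c)) by lra.
  field; split; lra.
Qed.

Lemma ddcosec_ge0 x : 1 <= x -> 0 <= ddcosec x.
Proof.
intros Hx; assert (H := sin_angle_gt0 x Hx); assert (Ht := angle_bounds x Hx).
assert (HD := two_sin_cos_le (PI / 2 / x) ltac:(lra)).
apply Rdiv_le_0_compat; [apply Rmult_le_pos; lra |].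
apply Rmult_lt_0_compat; apply pow_lt; lra.
Qed.

Lemma cosec_le x y : 1 <= x -> x <= y -> cosec x <= cosec y.
Proof.
intros Hx Hxy; apply (le_of_derive_ge0 cosec dcosec); [easy |].
intros z Hz; split; [apply is_derive_cosec | apply dcosec_ge0]; lra.
Qed.

Lemma dcosec_le x y : 1 <= x -> x <= y -> dcosec x <= dcosec y.
Proof.
intros Hx Hxy; apply (le_of_derive_ge0 dcosec ddcosec); [easy |].
intros z Hz; split; [apply is_derive_dcosec | apply ddcosec_ge0]; lra.
Qed.

(** By convexity, the increment of [cosec] over a step of fixed length [q - a] grows with the
    starting point; compare the starting points [a] and [p]. *)
Lemma cosec_spread a p q : 1 <= a -> a <= p -> a <= q ->
  cosec p + cosec q <= cosec a + cosec (p + q - a).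
Proof.
intros Ha Hp Hq.
assert (H : cosec (a + (q - a)) - cosec a <= cosec (p + (q - a)) - cosec p).
- apply (le_of_derive_ge0 (fun x => cosec (x + (q - a)) - cosec x)
    (fun x => dcosec (x + (q - a)) - dcosec x)); [lra |].
  intros x Hx; split.
  + assert (Hd := is_derive_cosec x ltac:(lra)).
    assert (Hd' := is_derive_cosec (x + (q - a)) ltac:(lra)).
    auto_derive.
    * split; [eexists; exact Hd' | split; [eexists; exact Hd | easy]].
    * replace (Derive (fun x => cosec x) x) with (dcosec x)
        by (symmetry; now apply is_derive_unique).
      replace (Derive (fun x => cosec x) (x + (q - a))) with (dcosec (x + (q - a)))
        by (symmetry; now apply is_derive_unique).
      ring.
  + assert (dcosec x <= dcosec (x + (q - a))) by (apply dcosec_le; lra); lra.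
- replace (a + (q - a)) with q in H by ring.
  replace (p + (q - a)) with (p + q - a) in H by ring; lra.
Qed.

Local Close Scope R_scope.

Require Import Defs.
From HB Require Import structures.
From mathcomp Require Import all_boot all_order all_algebra fingroup perm.
From mathcomp Require Import algC ring lra zify.
From mathcomp Require Import complex classical_sets reals Rstruct.
Import Order.TTheory GRing.Theory Num.Theory.
Local Open Scope ring_scope.
Set Implicit Arguments.
Unset Strict Implicit.
Unset Printing Implicit Defensive.

(** * Embedding the algebraic numbers into the complex numbers *)

Section ArchimedeanEmbedding.

Context (F : archiRealFieldType) (R : realType).

(** Since [F] is archimedean, the set is nonempty and bounded above, so [sup] is a genuine
    supremum. *)
Definition rat_cut (x : F) : R :=
  sup [set r : R | exists2 q : rat, ratr q < x & r = ratr q]%classic.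

Lemma rat_lt_approx (x : F) (d : rat) : 0 < d ->
  exists q : rat, ratr q < x < ratr (q + d).
Proof.
move=> d0; have /rat_in_itvoo[q] : x - ratr d < x by rewrite ltrBlDr ltrDl ltr0q.
by rewrite in_itv /= ltrBlDr -rmorphD => /andP[? ?]; exists q; apply/andP.
Qed.

Lemma rat_cut_bounds (x : F) (q r : rat) : ratr q < x -> x <= ratr r ->
  ratr q <= rat_cut x <= ratr r.
Proof.
move=> qx xr; set E := [set r : R | exists2 q : rat, ratr q < x & r = ratr q]%classic.
have ubE : ubound E (ratr r).
  by move=> _ [u ux ->]; rewrite ler_rat -(ler_rat F) ltW // (lt_le_trans ux).
have Eq : E (ratr q) by exists q.
apply/andP; split; last by apply: ge_sup ubE; exists (ratr q).
by apply: ub_le_sup Eq; exists (ratr r).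
Qed.

(** Restricting to [d < 1] lets errors quadratic in [d] be absorbed into the linear bound. *)
Lemma rat_close_eq (a b c : R) :
  (forall d : rat, 0 < d < 1 -> `|a - b| <= c * ratr d) -> a = b.
Proof.
move=> H; apply/eqP; rewrite -subr_eq0 -normr_eq0 eq_le normr_ge0 andbT.
apply/ler_addgt0Pr => e e0; rewrite add0r.
(* The summand 1 keeps the denominator positive when [c] is zero. *)
pose m := Num.min 1 (e / (`|c| + 1)).
have c1 : 0 < `|c| + 1 by rewrite ltr_wpDl.
have m0 : 0 < m by rewrite lt_min ltr01 divr_gt0.
have [d] := rat_in_itvoo m0; rewrite in_itv /= lt_min ltr0q => /andP[d0 /andP[d1 de]].
have d1' : d < 1 by rewrite -(ltr_rat R) rmorph1.
have := H d; rewrite d0 d1' => /(_ isT) Hd; apply: (le_trans Hd).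
apply: (@le_trans _ _ ((`|c| + 1) * ratr d)).
  by rewrite ler_wpM2r ?ler0q ?ltW // (le_lt_trans (ler_norm c)) // ltrDl.
by rewrite mulrC -ler_pdivlMr // ltW.
Qed.

(** If [x] and [y] are known up to [d], with lower bounds [q] and [r], both sides lie between
    [q + r] and [q + r + 2 * d]. *)
Lemma rat_cutD : {morph rat_cut : x y / x + y}.
Proof.
move=> x y; apply: (@rat_close_eq _ _ 2) => d /andP[d0 _].
have [q /andP[qx xq]] := rat_lt_approx x d0.
have [r /andP[ry yr]] := rat_lt_approx y d0.
have := rat_cut_bounds qx (ltW xq); have := rat_cut_bounds ry (ltW yr).
have lt_xy : ratr (q + r) < x + y by rewrite rmorphD ltrD.
have xy_le : x + y <= ratr (q + d + (r + d)) by rewrite (rmorphD _ (q + d)) lerD // ltW.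
have := rat_cut_bounds lt_xy xy_le.
rewrite !rmorphD /= {xy_le lt_xy qx xq ry yr}.
move: (rat_cut _) (rat_cut _) (rat_cut _) (ratr q) (ratr r) (ratr d).
move=> c a b q' r' d' /andP[? ?] /andP[? ?] /andP[? ?].
rewrite ler_norml; apply/andP; split; lra.
Qed.

Lemma le_rat_cut : {homo rat_cut : x y / x <= y}.
Proof.
move=> x y; rewrite le_eqVlt => /predU1P[-> // | /rat_in_itvoo[q]].
rewrite in_itv /= => /andP[xq qy].
have [r /andP[rx _]] := rat_lt_approx x ltr01.
have [s /andP[_ ys]] := rat_lt_approx y ltr01.
have /andP[_ le1] := rat_cut_bounds rx (ltW xq).
by have /andP[+ _] := rat_cut_bounds qy (ltW ys); apply: le_trans.
Qed.

Lemma rat_cut_rat (q : rat) : rat_cut (ratr q) = ratr q.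
Proof.
apply: (@rat_close_eq _ _ 1) => d /andP[d0 _].
have qd : ratr (q - d) < ratr q :> F by rewrite ltr_rat ltrBlDr ltrDl.
have := rat_cut_bounds qd (lexx _); rewrite rmorphB => /andP[? ?].
by rewrite ler_norml; apply/andP; split; lra.
Qed.

Lemma rat_cutB : zmod_morphism rat_cut.
Proof. by move=> x y; rewrite -[x in RHS](subrK y) (rat_cutD (x - y)) addrK. Qed.

HB.instance Definition _ := GRing.isZmodMorphism.Build F R rat_cut rat_cutB.

(** Both sides lie between the squares of [q] and [q + d], which differ by [(2 * q + d) * d]; here
    [q] is at most [rat_cut x] and [d < 1]. *)
Lemma rat_cut_sqr_pos (x : F) : 0 < x -> rat_cut (x ^+ 2) = rat_cut x ^+ 2.
Proof.
move=> x0; apply: (@rat_close_eq _ _ (2 * rat_cut x + 1)) => d /andP[d0 d1].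
have [q [q0 qx xq]] : exists q : rat, [/\ 0 <= q, ratr q <= x & x <= ratr (q + d)].
  have [q /andP[qx xq]] := rat_lt_approx x d0.
  (* The lower bound is clipped at 0 so that squaring is monotone on the interval. *)
  exists (Num.max 0 q); split; first by rewrite le_max lexx.
    by case: (leP 0 q) => _; [exact: ltW | rewrite rmorph0 ltW].
  by rewrite (le_trans (ltW xq)) // ler_rat lerD2r le_max lexx orbT.
have d0' : 0 < ratr d :> R by rewrite ltr0q.
have d1' : ratr d < 1 :> R by rewrite -(rmorph1 (@ratr R)) ltr_rat.
have q0' : 0 <= ratr q :> R by rewrite ler0q.
have qx2 : rat_cut (ratr (q ^+ 2)) <= rat_cut (x ^+ 2).
  by apply: le_rat_cut; rewrite rmorphXn ler_pXn2r // nnegrE ?ler0q // ltW.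
have xq2 : rat_cut (x ^+ 2) <= rat_cut (ratr ((q + d) ^+ 2)).
  by apply: le_rat_cut; rewrite rmorphXn ler_pXn2r // nnegrE ?ler0q ?addr_ge0 // ltW.
move: (le_rat_cut qx) (le_rat_cut xq) qx2 xq2; rewrite !rat_cut_rat !rmorphXn !rmorphD /=.
move: (rat_cut x) (rat_cut (x ^+ 2)) (ratr q) (ratr d) d0' d1' q0' => u v a b *.
by rewrite ler_norml; apply/andP; split; nra.
Qed.

Lemma rat_cut_sqr (x : F) : rat_cut (x ^+ 2) = rat_cut x ^+ 2.
Proof.
have [x0|x0|<-] := ltgtP 0 x; first exact: rat_cut_sqr_pos.
  by rewrite -sqrrN rat_cut_sqr_pos ?oppr_gt0 // raddfN sqrrN.
by rewrite expr0n /= raddf0 expr0n.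
Qed.

(* Polarisation: an additive map commuting with squaring is multiplicative. *)
Lemma rat_cut_monoid_morphism : monoid_morphism rat_cut.
Proof.
split; first by rewrite -[1](rmorph1 (@ratr F)) rat_cut_rat rmorph1.
move=> x y; have := rat_cut_sqr (x + y).
rewrite [rat_cut (x + y)]raddfD !sqrrD !raddfD /= !rat_cut_sqr => /(addIr _)/(addrI _).
by rewrite -mulr2n => /eqP; rewrite eqr_pMn2r // => /eqP.
Qed.

HB.instance Definition _ :=
  GRing.isMonoidMorphism.Build F R rat_cut rat_cut_monoid_morphism.

Lemma rat_cut_norm (x : F) : rat_cut `|x| = `|rat_cut x|.
Proof.
have cut0 : rat_cut 0 = 0 by exact: raddf0.
have [x0|x0] := leP 0 x.
  have : 0 <= rat_cut x by rewrite -cut0 le_rat_cut.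
  by move/ger0_norm->; rewrite ger0_norm.
have : rat_cut x <= 0 by rewrite -cut0 le_rat_cut // ltW.
by move/ler0_norm->; rewrite ltr0_norm // raddfN.
Qed.

Lemma ler_rat_cut : {mono rat_cut : x y / x <= y}.
Proof.
apply: le_mono => x y xy; rewrite lt_neqAle le_rat_cut ?ltW // andbT.
by rewrite (inj_eq (fmorph_inj _)) lt_eqF.
Qed.

End ArchimedeanEmbedding.

Section AlgCEmbedding.

Context (R : realType).
Local Notation cut := (@rat_cut algR R).

Definition Re_algR (z : algC) : algR := in_algR (Creal_Re z).
Definition Im_algR (z : algC) : algR := in_algR (Creal_Im z).

(** Built from real and imaginary parts so that it respects both them and the order on reals, which
    an arbitrary field embedding need not do. *)
Definition embC (z : algC) : R[i] := Complex (cut (Re_algR z)) (cut (Im_algR z)).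

Lemma embC_zmod_morphism : zmod_morphism embC.
Proof.
move=> x y; rewrite /embC.
have -> : Re_algR (x - y) = Re_algR x - Re_algR y by apply: val_inj; rewrite /= raddfB.
have -> : Im_algR (x - y) = Im_algR x - Im_algR y by apply: val_inj; rewrite /= raddfB.
by rewrite !raddfB.
Qed.

Lemma embC_monoid_morphism : monoid_morphism embC.
Proof.
split; rewrite /embC.
  have -> : Re_algR 1 = 1 by apply: val_inj; rewrite /= (Creal_ReP _ _) ?rpred1.
  have -> : Im_algR 1 = 0 by apply: val_inj; rewrite /= (Creal_ImP _ _) ?rpred1.
  by rewrite rmorph0 rmorph1.
move=> x y.
have -> : Re_algR (x * y) = Re_algR x * Re_algR y - Im_algR x * Im_algR y.
  by apply: val_inj; rewrite /= ReM.
have -> : Im_algR (x * y) = Re_algR x * Im_algR y + Im_algR x * Re_algR y.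
  by apply: val_inj; rewrite /= ImM ['Im x * _]mulrC.
have cutM (a b : algR) : cut (a * b) = cut a * cut b by apply: (rmorphM cut).
by rewrite (rat_cutB _ (Re_algR x * _)) (rat_cutD _ (Re_algR x * _)) !cutM.
Qed.

HB.instance Definition _ := GRing.isZmodMorphism.Build algC R[i] embC embC_zmod_morphism.
HB.instance Definition _ := GRing.isMonoidMorphism.Build algC R[i] embC embC_monoid_morphism.

Lemma Re_embC_le (x y : algC) : x \is Num.real -> y \is Num.real ->
  (complex.Re (embC x) <= complex.Re (embC y)) = (x <= y).
Proof.
move=> xR yR; rewrite /= ler_rat_cut.
by rewrite -[LHS]/('Re x <= 'Re y) (Creal_ReP _ xR) (Creal_ReP _ yR).
Qed.

Lemma Re_embC_norm_Re (z : algC) :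
  complex.Re (embC `|'Re z|) = `|complex.Re (embC z)|.
Proof.
rewrite /= -rat_cut_norm; congr cut; apply: val_inj => /=.
by rewrite (Creal_ReP _ _) ?normr_real.
Qed.

End AlgCEmbedding.

(** * The characteristic polynomial *)

Lemma mem_zip_rot1 (T : eqType) (c : seq T) (x y : T) : uniq c ->
  ((x, y) \in zip c (rot 1 c)) = (x \in c) && (y == next c x).
Proof.
case: c => [|a s] // Uc; rewrite rot1_cons.
have szz : size (zip (a :: s) (rcons s a)) = (size s).+1.
  by rewrite size_zip size_rcons minnn.
(* With default [a], reading [s] just past its end yields [a]: this is the arc that closes the
   cycle. *)
have nth_zipE i : nth (a, a) (zip (a :: s) (rcons s a)) i
    = (nth a (a :: s) i, nth a s i).
  by rewrite nth_zip ?size_rcons // -[in RHS](nth_rcons_default a s).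
apply/(nthP (a, a))/andP => [[k] | [xc /eqP->]].
  rewrite szz nth_zipE => ltk [<- <-].
  by rewrite mem_nth // next_nth mem_nth // index_uniq.
exists (index x (a :: s)); first by rewrite szz -[X in (_ < X)%N]/(size (a :: s)) index_mem.
by rewrite nth_zipE nth_index // next_nth xc.
Qed.

Lemma next_notin (T : eqType) (c : seq T) (x : T) : x \notin c -> next c x = x.
Proof. by rewrite next_nth => /negPf ->. Qed.

Lemma next_neq (T : finType) (c : seq T) (x : T) :
  uniq c -> (1 < size c)%N -> x \in c -> next c x != x.
Proof.
move=> Uc sz xc.
have := orbit_uniq (next c) x.
rewrite /orbit (order_cycle (cycle_next Uc) Uc xc).
case: (size c) sz => [|[|k]] //= _.
by rewrite inE negb_or eq_sym => /andP[/andP[]].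
Qed.

Lemma dcycleP (n : nat) (A : 'M[int]_n) (C : {set 'I_n * 'I_n}) :
  is_dcycle A C <-> exists c : seq 'I_n,
    [/\ uniq c, (1 < size c)%N, {in c, forall x, Defs.arc A x (next c x)} &
        forall x y, ((x, y) \in C) = (x \in c) && (y == next c x)].
Proof.
split=> -[c [Uc sz arcs CE]]; exists c; split=> //.
- move=> x xc; have /(_ (x, next c x)) := allP arcs.
  by apply; rewrite mem_zip_rot1 // xc eqxx.
- by move=> x y; rewrite CE inE mem_zip_rot1.
- by apply/allP => -[x y]; rewrite mem_zip_rot1 // => /andP[xc /eqP->]; apply: arcs.
- by apply/setP => -[x y]; rewrite CE inE mem_zip_rot1.
Qed.

Lemma odd_permX (T : finType) (s : {perm T}) (k : nat) :
  odd_perm (s ^+ k)%g = odd k && odd_perm s.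
Proof.
elim: k => [|k IHk]; first by rewrite odd_perm1.
by rewrite expgS odd_permM IHk /=; case: (odd k) (odd_perm s) => [] [].
Qed.

Section Cycle.

Context (n : nat) (A : 'M[int]_n) (C : {set 'I_n * 'I_n}) (c : seq 'I_n).
Hypothesis Uc : uniq c.
Hypothesis CE : forall x y, ((x, y) \in C) = (x \in c) && (y == next c x).

Lemma cycle_imset : C = [set (x, next c x) | x in c].
Proof.
apply/setP => -[x y]; rewrite CE; apply/andP/imsetP => [[xc /eqP->]|[z zc [-> ->]]].
  by exists x.
by rewrite zc eqxx.
Qed.

Lemma cycle_lenE : cycle_len C = size c.
Proof.
rewrite /cycle_len cycle_imset card_imset; first exact/card_uniqP.
by move=> x y [].
Qed.

Lemma cycle_vertsE : cycle_verts C =i c.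
Proof.
move=> x; apply/imsetP/idP => [[[y z]]|xc].
  by rewrite CE => /andP[yc _] ->.
by exists (x, next c x); rewrite ?CE ?xc ?eqxx.
Qed.

Lemma cycle_signE : cycle_sign A C = \prod_(i in c) A i (next c i).
Proof. by rewrite /cycle_sign cycle_imset big_imset //= => x y _ _ []. Qed.

Definition next_perm : {perm 'I_n} := perm (can_inj (prev_next Uc)).

Lemma next_permE x : next_perm x = next c x.
Proof. exact: permE. Qed.

(** An odd power of the rotation is the identity, so its signature is trivial. *)
Lemma next_perm_even : odd (size c) -> odd_perm next_perm = false.
Proof.
move=> oc; have : (next_perm ^+ size c)%g = 1%g.
  apply/permP => x; rewrite permX perm1 (eq_iter next_permE).
  have [xc|xc] := boolP (x \in c).
    rewrite -[in LHS](order_cycle (cycle_next Uc) Uc xc).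
    exact/iter_order/(can_inj (prev_next Uc)).
  by elim: (size c) => //= k ->; apply: next_notin.
by move=> /(congr1 (@odd_perm _)); rewrite odd_permX oc odd_perm1.
Qed.

End Cycle.

(** This links the Leibniz formula to the digraph: the nontrivial orbits of a permutation that moves
    points only along arcs are directed cycles. *)
Lemma moved_orbit_dcycle (n : nat) (A : 'M[int]_n) (s : {perm 'I_n}) (x : 'I_n) :
  (forall i, s i != i -> Defs.arc A i (s i)) -> s x != x ->
  is_dcycle A [set e | (e.1 \in orbit s x) && (e.2 == s e.1)].
Proof.
move=> arcs sx; apply/dcycleP; exists (orbit s x).
have cyc : fcycle s (orbit s x) := cycle_orbit (@perm_inj _ s) x.
have sz : (1 < size (orbit s x))%N.
  rewrite size_orbit ltnNge leq_eqVlt ltnS leqn0 negb_or -lt0n fingraph.order_gt0 andbT.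
  apply: contraNN sx => /eqP o1.
  by have := iter_order (@perm_inj _ s) x; rewrite o1 /= => ->.
split=> //; first exact: orbit_uniq.
- move=> y yx; rewrite (nextE cyc yx); apply: arcs.
  by rewrite -(nextE cyc yx) next_neq ?orbit_uniq.
- by move=> y z; rewrite inE /=; case yx: (_ \in _) => //=; rewrite (nextE cyc yx).
Qed.

(** Each fixed point contributes a factor ['X], as there are no loops; each moved point contributes
    an off-diagonal entry. *)
Lemma prod_char_poly_mx (n : nat) (A : 'M[int]_n) (s : {perm 'I_n}) (V : {set 'I_n}) :
  (forall i, A i i = 0) -> (forall i, (s i != i) = (i \in V)) ->
  \prod_i char_poly_mx A i (s i)
    = 'X^(n - #|V|) * (\prod_(i in V) - A i (s i))%:P.
Proof.
move=> A0 sV; rewrite (bigID (mem V)) /= mulrC; congr (_ * _).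
  rewrite (eq_bigr (fun=> 'X)) => [|i iV].
    have -> : (n - #|V|)%N = #|~: V| by rewrite [RHS]cardsCs finset.setCK card_ord.
    rewrite big_const iter_mulr_1.
    by congr ('X ^+ _); apply: eq_card => i; rewrite !inE.
  have /eqP-> : s i == i by rewrite -[_ == _]negbK sV.
  by rewrite !mxE eqxx A0 subr0.
rewrite rmorph_prod; apply: eq_bigr => i iV /=.
by rewrite !mxE (eq_sym i) (negPf (_ : s i != i)) ?sV // mulr0n sub0r polyCN.
Qed.

Lemma prod_char_poly_mx_eq0 (n : nat) (A : 'M[int]_n) (s : {perm 'I_n}) (i : 'I_n) :
  s i != i -> ~~ Defs.arc A i (s i) -> \prod_i char_poly_mx A i (s i) = 0.
Proof.
move=> si /negPn/eqP Ai; apply/eqP/prodf_eq0; exists i => //.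
by rewrite !mxE (eq_sym i) (negPf si) Ai mulr0n subr0.
Qed.

Lemma cycle_sign_pm1 (n : nat) (A : 'M[int]_n) (C : {set 'I_n * 'I_n}) :
  sidigraph A -> is_dcycle A C -> cycle_sign A C = 1 \/ cycle_sign A C = -1.
Proof.
move=> [A01 _] /dcycleP[c [Uc _ arcs CE]]; rewrite (cycle_signE A CE).
apply: (big_ind (fun z => z = 1 \/ z = -1 :> int)); first by left.
  by move=> x y [->|->] [->|->]; rewrite ?mul1r ?mulr1 ?mulrNN; auto.
move=> i ic; have := A01 i (next c i); have := arcs i ic; rewrite /Defs.arc !inE.
by case/negPf=> -> /= /orP[]/eqP->; auto.
Qed.

Section TwoCycles.

Context (n : nat) (A : 'M[int]_n) (C1 C2 : {set 'I_n * 'I_n}).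
Hypotheses (A0 : forall i, A i i = 0).
Hypothesis only : forall C, is_dcycle A C -> C = C1 \/ C = C2.
Context (c1 c2 : seq 'I_n).
Hypotheses (U1 : uniq c1) (U2 : uniq c2).
Hypotheses (sz1 : (1 < size c1)%N) (sz2 : (1 < size c2)%N).
Hypothesis C1E : forall x y, ((x, y) \in C1) = (x \in c1) && (y == next c1 x).
Hypothesis C2E : forall x y, ((x, y) \in C2) = (x \in c2) && (y == next c2 x).
Hypothesis c12 : forall x, x \in c1 -> x \in c2 -> False.

Local Notation s1 := (next_perm U1).
Local Notation s2 := (next_perm U2).

(** The orbit of [x] is a directed cycle, hence [C1] or [C2]. Equality of arc sets, and not only of
    vertex sets, identifies [s] with the rotation. *)
Lemma moved_on_cycle (s : {perm 'I_n}) (x : 'I_n) :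
  (forall i, s i != i -> Defs.arc A i (s i)) -> s x != x ->
  x \in c1 /\ {in c1, s =1 s1} \/ x \in c2 /\ {in c2, s =1 s2}.
Proof.
move=> arcs sx; have /only := moved_orbit_dcycle arcs sx.
have x_orb : (x, s x) \in [set e | (e.1 \in orbit s x) && (e.2 == s e.1)].
  by rewrite inE /= in_orbit eqxx.
case=> E; [left | right]; rewrite E ?C1E ?C2E in x_orb; case/andP: x_orb => xc _;
  split=> // y yc; rewrite next_permE.
  have: (y, next c1 y) \in C1 by rewrite C1E yc eqxx.
  by rewrite -E inE => /andP[_ /eqP].
have: (y, next c2 y) \in C2 by rewrite C2E yc eqxx.
by rewrite -E inE => /andP[_ /eqP].
Qed.

(** On each cycle [s] is the identity or the full rotation, and it fixes all other vertices; two
    independent choices leave four permutations. *)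
Lemma contributing_perm (s : {perm 'I_n}) :
  (forall i, s i != i -> Defs.arc A i (s i)) ->
  [\/ s = 1%g, s = s1, s = s2 | s = (s1 * s2)%g].
Proof.
move=> arcs.
have on_cycle (c : seq 'I_n) (Uc : uniq c) :
    (forall x, x \in c -> s x != x -> {in c, s =1 next_perm Uc}) ->
    {in c, s =1 id} \/ {in c, s =1 next_perm Uc}.
  move=> Hc; have [/hasP[x xc sx]|/hasPn none] := boolP (has (fun x => s x != x) c).
    by right; apply: Hc sx.
  by left=> x /none /negPn/eqP.
have off x : x \notin c1 -> x \notin c2 -> s x = x.
  move=> x1 x2; apply/eqP/negPn/negP => sx.
  by case: (moved_on_cycle arcs sx) => -[]; rewrite ?(negPf x1) ?(negPf x2).
have H1 x : x \in c1 -> s x != x -> {in c1, s =1 s1}.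
  by move=> xc /(moved_on_cycle arcs)[] [] // /(c12 xc).
have H2 x : x \in c2 -> s x != x -> {in c2, s =1 s2}.
  by move=> xc /(moved_on_cycle arcs)[] [] // /c12 /(_ xc).
have s1off x : x \notin c1 -> s1 x = x by rewrite next_permE; apply: next_notin.
have s2off x : x \notin c2 -> s2 x = x by rewrite next_permE; apply: next_notin.
have s1c2 x : x \in c2 -> s1 x = x.
  by move=> x2; apply: s1off; apply/negP => /c12; apply.
have s2c1 x : x \in c1 -> s2 (s1 x) = s1 x.
  by move=> x1; apply: s2off; rewrite next_permE; apply/negP; apply: c12; rewrite mem_next.
have s2c1' x : x \in c1 -> s2 x = x.
  by move=> x1; apply: s2off; apply/negP; apply: c12.
case: (on_cycle _ U1 H1) => E1; case: (on_cycle _ U2 H2) => E2;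
  [constructor 1 | constructor 3 | constructor 2 | constructor 4];
  apply/permP => x; rewrite ?permM ?perm1;
  (have [x1|x1] := boolP (x \in c1); first by rewrite E1 // ?s2c1 // s2c1');
  (have [x2|x2] := boolP (x \in c2); first by rewrite E2 // s1c2);
  by rewrite off // ?s1off // s2off.
Qed.

Lemma uniq_two_cycles : uniq (c1 ++ c2).
Proof.
rewrite cat_uniq U1 U2 andbT; apply/hasPn => x x2; apply/negP => /= x1.
exact: (c12 x1 x2).
Qed.

Lemma size_two_cycles : (size c1 + size c2 <= n)%N.
Proof.
rewrite -size_cat -[leqRHS]card_ord -(card_uniqP uniq_two_cycles).
exact: max_card.
Qed.

(** The four surviving Leibniz terms are exactly the four terms obtained by multiplying out the
    right-hand side. *)
Lemma char_poly_expand : odd (size c1) -> odd (size c2) ->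
  char_poly A = 'X^(n - size c1 - size c2)
    * ('X^(size c1) - (cycle_sign A C1)%:P) * ('X^(size c2) - (cycle_sign A C2)%:P).
Proof.
move=> o1 o2.
have mv (c : seq 'I_n) (Uc : uniq c) (sz : (1 < size c)%N) i :
    (next_perm Uc i != i) = (i \in [set x in c]).
  rewrite next_permE inE; have [ic|ic] := boolP (i \in c); first exact: next_neq.
  by rewrite next_notin ?eqxx.
have card_c (c : seq 'I_n) (Uc : uniq c) : #|[set x in c]| = size c.
  by rewrite cardsE; apply/card_uniqP.
have s1E i : i \in c2 -> s1 i = i.
  by move=> i2; rewrite next_permE next_notin //; apply/negP => /c12; apply.
have s2E i : i \in c1 -> s2 (s1 i) = s1 i.
  move=> i1; rewrite [LHS]next_permE next_notin //; apply/negP; apply: c12.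
  by rewrite next_permE mem_next.
have mv12 i : ((s1 * s2)%g i != i) = (i \in [set x in c1 ++ c2]).
  rewrite permM inE mem_cat; have [i1|i1] := boolP (i \in c1).
    by rewrite s2E // mv // inE.
  by rewrite [s1 i]next_permE (next_notin i1) mv // inE.
(* An odd number of negated entries leaves a single minus sign. *)
have w (c : seq 'I_n) (C : {set 'I_n * 'I_n}) (s : {perm 'I_n}) :
    odd (size c) -> uniq c ->
    (forall x y, ((x, y) \in C) = (x \in c) && (y == next c x)) ->
    {in c, s =1 next c} ->
    \prod_(i in c) - A i (s i) = - cycle_sign A C.
  move=> oc Uc CE sE; rewrite (cycle_signE A CE) prodrN.
  have -> : #|c| = size c by apply/card_uniqP.
  rewrite -signr_odd oc mulN1r; congr (- _).
  by apply: eq_bigr => i /sE ->.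
(* Witnesses on both cycles show that the four permutations are pairwise distinct, so that each term
   can be extracted from the sum once. *)
have ex1 : exists i, i \in c1 by case: c1 sz1 => // i ? _; exists i; rewrite inE eqxx.
have ex2 : exists i, i \in c2 by case: c2 sz2 => // i ? _; exists i; rewrite inE eqxx.
have [i1 ic1] := ex1; have [i2 ic2] := ex2.
have i12 : i2 \notin c1 by apply/negP => /c12; apply.
have i21 : i1 \notin c2 by apply/negP; apply: c12.
have d1 : s1 != 1%g.
  by apply/eqP => /permP/(_ i1)/eqP; apply/negP; rewrite perm1 mv // inE.
have d2 : s2 != 1%g.
  by apply/eqP => /permP/(_ i2)/eqP; apply/negP; rewrite perm1 mv // inE.
have d12 : s2 != s1.
  apply: contraTneq ic2 => e; have := mv _ U2 sz2 i2; rewrite e mv // !inE => <-.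
  exact: i12.
have d3 : (s1 * s2)%g != 1%g.
  by apply/eqP => /permP/(_ i1)/eqP; apply/negP; rewrite perm1 mv12 // inE mem_cat ic1.
have d31 : (s1 * s2)%g != s1 by rewrite -[X in _ != X]mulg1 (inj_eq (mulgI _)).
have d32 : (s1 * s2)%g != s2 by rewrite -[X in _ != X]mul1g (inj_eq (mulIg _)).
rewrite /char_poly /determinant (bigD1 1%g) //= (bigD1 s1) ?d1 //=.
rewrite (bigD1 s2) ?d2 ?d12 //= (bigD1 (s1 * s2)%g) ?d3 ?d31 ?d32 //=
  [X in _ + (_ + (_ + (_ + X)))]big1 ?addr0; last first.
  move=> s; case/andP=> /andP[/andP[n1 ns1] ns2] ns12.
  have [/forallP arcs|] := boolP [forall i, (s i != i) ==> Defs.arc A i (s i)].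
    have := contributing_perm (fun i => implyP (arcs i)).
    by case=> E; rewrite E eqxx in n1 ns1 ns2 ns12.
  rewrite negb_forall => /existsP[k]; rewrite negb_imply => /andP[si nA].
  by rewrite (prod_char_poly_mx_eq0 si nA) mulr0.
rewrite (prod_char_poly_mx A0 (V := finset.set0)); last by move=> i; rewrite perm1 eqxx inE.
rewrite (prod_char_poly_mx A0 (mv _ U1 sz1)) (prod_char_poly_mx A0 (mv _ U2 sz2)).
rewrite (prod_char_poly_mx A0 mv12) !card_c ?uniq_two_cycles // cards0 big_set0 subn0.
rewrite odd_permM !next_perm_even // odd_perm1 !mul1r.
rewrite !big_set /= size_cat.
rewrite (w c1 C1) // ?(w c2 C2) //; try by move=> i _; rewrite next_permE.
have -> : \prod_(i in c1 ++ c2) - A i ((s1 * s2)%g i) = cycle_sign A C1 * cycle_sign A C2.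
  rewrite -mulrNN (bigID (mem c1)) /=; congr (_ * _).
    rewrite -(w c1 C1 (s1 * s2)%g o1 U1 C1E); last first.
      by move=> i ic; rewrite permM s2E // next_permE.
    by apply: eq_bigl => i; rewrite mem_cat; case: (i \in c1); rewrite ?andbF.
  rewrite -(w c2 C2 (s1 * s2)%g o2 U2 C2E); last first.
    by move=> i ic; rewrite permM s1E // next_permE.
  apply: eq_bigl => i; rewrite mem_cat; have [ic|_] := boolP (i \in c1); last by rewrite andbT.
  by rewrite andbF; apply/esym/negP; apply: c12.
move: size_two_cycles; move: (size c1) (size c2) (cycle_sign A C1) (cycle_sign A C2).
move=> p q a b le_pq.
(* Natural subtraction is truncated, so these splittings rely on [le_pq]; afterwards only a ring
   identity remains. *)
have Xn : 'X^n = 'X^(n - p - q) * 'X^p * 'X^q :> {poly int}.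
  by rewrite -!exprD -subnDA -addnA subnK.
have Xp : 'X^(n - p) = 'X^(n - p - q) * 'X^q :> {poly int}.
  by rewrite -exprD subnK // leq_subRL ?(leq_trans _ le_pq) ?leq_addr.
have Xq : 'X^(n - q) = 'X^(n - p - q) * 'X^p :> {poly int}.
  by rewrite subnAC -exprD subnK // leq_subRL ?(leq_trans _ le_pq) ?leq_addl // addnC.
rewrite Xn Xp Xq subnDA !polyCN polyCM polyC1; ring.
Qed.

End TwoCycles.

Lemma two_cycles_char_poly (n : nat) (A : 'M[int]_n) (p q : nat) :
  two_cycles A p q -> odd p -> odd q ->
  [/\ (1 < p)%N, (1 < q)%N, (p + q <= n)%N &
    exists e1 e2 : int, [/\ e1 = 1 \/ e1 = -1, e2 = 1 \/ e2 = -1 &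
      char_poly A = 'X^(n - p - q) * ('X^p - e1%:P) * ('X^q - e2%:P)]].
Proof.
move=> [sA [_ [C1 [C2 [dC1 dC2 dis only [<- <-]]]]]] op oq.
have [[_ A0] [pm1 pm2]] := (sA, (cycle_sign_pm1 sA dC1, cycle_sign_pm1 sA dC2)).
have /dcycleP[c1 [U1 sz1 _ C1E]] := dC1; have /dcycleP[c2 [U2 sz2 _ C2E]] := dC2.
move: op oq; rewrite (cycle_lenE U1 C1E) (cycle_lenE U2 C2E) => op oq.
have c12 x : x \in c1 -> x \in c2 -> False.
  rewrite -(cycle_vertsE C1E) -(cycle_vertsE C2E) => x1.
  by rewrite (disjointFr dis x1).
split=> //; first exact: size_two_cycles c12.
exists (cycle_sign A C1), (cycle_sign A C2); split=> //.
exact: char_poly_expand.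
Qed.

(** * Roots of plus and minus one *)

Local Notation Rt := Rdefinitions.R.

Arguments sin x%_ring_scope.
Arguments cos x%_ring_scope.

Definition cis (t : Rt) : Rt[i] := Complex (cos t) (sin t).

Arguments cis t%_ring_scope.

Lemma cisD (s t : Rt) : cis (s + t) = cis s * cis t.
Proof. by rewrite /cis cosD sinD [sin s * cos t + _]addrC. Qed.

Lemma cisX (t : Rt) (k : nat) : cis t ^+ k = cis (t *+ k).
Proof.
elim: k => [|k IHk]; last by rewrite exprS IHk mulrS cisD.
by rewrite mulr0n /cis cos_0 sin_0.
Qed.

Lemma cis_PI : cis PI = -1.
Proof. by apply/eqP; rewrite eq_complex /= cos_PI sin_PI oppr0 !eqxx. Qed.

(** For odd [p] the base is a [p]-th root of unity, and a sign [e] is its own [p]-th power. Up to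
    sign the angles are then the multiples of [PI / p] below [PI]. *)
Definition odd_root (e : int) (p j : nat) : Rt[i] :=
  e%:~R * (- cis (PI / p%:R)) ^+ j.

Lemma odd_root_exp (e : int) (p j : nat) : odd p -> e = 1 \/ e = -1 ->
  odd_root e p j ^+ p = e%:~R.
Proof.
move=> op e1; rewrite /odd_root exprMn exprAC exprNn cisX -[_ *+ p]mulr_natr.
rewrite divfK ?pnatr_eq0; last by case: p op.
rewrite cis_PI -signr_odd op mulrNN mulr1 expr1n mulr1 -rmorphXn /=.
by case: e1 => ->; rewrite ?expr1n // -signr_odd op.
Qed.

(** A coincidence would make a [k]-th power of the base equal to 1 for some [0 < k < p], but its
    imaginary part is, up to sign, the sine of an angle strictly between 0 and [PI]. *)
Lemma odd_root_inj (e : int) (p : nat) : odd p -> e = 1 \/ e = -1 ->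
  {in gtn p &, injective (odd_root e p)}.
Proof.
move=> op e1; suff H i k : (0 < k)%N -> (i + k < p)%N -> odd_root e p i <> odd_root e p (i + k).
  move=> i j; rewrite !inE => ip jp ij; have [lij|lji|//] := ltngtP i j.
    by case: (@H i (j - i)%N); rewrite ?subn_gt0 ?subnKC // ltnW.
  by case: (@H j (i - j)%N); rewrite ?subn_gt0 ?subnKC // ltnW.
move=> k0 ikp; rewrite /odd_root exprD mulrA.
set z := _ * _ ^+ i => E.
have z0 : z != 0.
  apply: contraTneq isT => z0; have := @odd_root_exp e p i op e1.
  rewrite -/z /odd_root -/z z0 expr0n; case: p op {ikp E z z0} => // p _ /= /esym/eqP.
  by rewrite intr_eq0; case: e1 => ->.
move/esym/eqP: E; rewrite -{2}[z]mulr1 (inj_eq (mulfI z0)) exprNn cisX -[_ *+ k]mulr_natr.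
have p0 : (0 < p)%N by case: (p) op.
have p0R : (0 : Rt) < p%:R by rewrite ltr0n.
have PI0 : (0 : Rt) < PI by apply/RltP/PI_RGT_0.
have t0 : (0 : Rt) < PI / p%:R * k%:R.
  by rewrite mulr_gt0 ?divr_gt0 ?ltr0n.
have tPI : PI / p%:R * k%:R < PI :> Rt.
  rewrite mulrAC ltr_pdivrMr // ltr_pM2l // ltr_nat.
  by rewrite (leq_ltn_trans _ ikp) ?leq_addl.
have /lt_eqF : 0 < sin (PI / p%:R * k%:R) by apply/RltP/sin_gt_0; apply/RltP.
rewrite eq_sym eq_complex -signr_odd => s0 /andP[_].
by case: (odd k); rewrite ?mulN1r ?mul1r /= ?oppr_eq0 s0.
Qed.

Lemma Xn_sub_pm1_factor (e : int) (p : nat) : odd p -> e = 1 \/ e = -1 ->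
  'X^p - e%:~R%:P = \prod_(z <- [seq odd_root e p j | j <- iota 0 p]) ('X - z%:P).
Proof.
move=> op e1; have p0 : (0 < p)%N by case: p op.
rewrite (@all_roots_prod_XsubC _ ('X^p - e%:~R%:P) [seq odd_root e p j | j <- iota 0 p]).
- by rewrite lead_coefXnsubC // scale1r.
- by rewrite size_XnsubC // size_map size_iota.
- by apply/allP => _ /mapP[j _ ->]; rewrite rootE !hornerE odd_root_exp // subrr.
rewrite uniq_rootsE map_inj_in_uniq ?iota_uniq // => i j.
by rewrite !mem_iota !add0n => ip jp; apply: odd_root_inj.
Qed.

(** The absolute value forgets [e], which is why positive and negative odd cycles have the same
    energy. *)
Lemma norm_Re_odd_root (e : int) (p j : nat) : e = 1 \/ e = -1 ->
  `|complex.Re (odd_root e p j)| = `|cos (PI / p%:R *+ j)|.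
Proof.
move=> e1; rewrite /odd_root exprNn cisX -signr_odd.
have normN (z : Rt[i]) : `|complex.Re (- z)| = `|complex.Re z| by case: z => a b /=; rewrite normrN.
by case: e1 => ->; case: (odd j); rewrite ?rmorphN ?rmorph1 ?mulN1r ?mul1r ?normN.
Qed.

(** * The telescoping sum of absolute cosines *)

Lemma half_PI : PI / 2 = Rdiv PI (IZR 2).
Proof. by rewrite RdivE -(INRE 2) INR_IZR_INZ. Qed.

Lemma two_sin_cos (a b : Rt) : 2 * sin a * cos b = sin (b + a) - sin (b - a).
Proof. rewrite !sinD -!RoppE cos_neg sin_neg !RoppE; ring. Qed.

(** The cosine changes sign between the indices [m] and [m.+1]. Each half telescopes by
    [two_sin_cos], and the halves meet at the angle [PI / 2]. *)
Lemma sum_norm_cos (m : nat) (a : Rt) : a *+ (m.*2.+1) = PI / 2 ->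
  sin a * (\sum_(j < m.*2.+1) `|cos (a *+ j.*2)|) = 1.
Proof.
move=> aPI; have PI0 : 0 < PI by apply/RltP/PI_RGT_0.
have a0 : 0 < a by rewrite -(pmulrn_lgt0 _ (ltn0Sn m.*2)) aPI divr_gt0.
have PIE : a *+ m.*2.+1.*2 = PI by rewrite -muln2 mulrnA aPI mulr2n -splitr.
have half : sin (PI / 2) = 1 by rewrite half_PI sin_PI2.
have stepE j : 2 * sin a * cos (a *+ j.*2) = sin (a *+ j.*2.+1) - sin (a *+ j.*2 - a).
  by rewrite two_sin_cos mulrSr.
(* Subtracting [a] as a real number keeps the formula valid at [k = 0], where the two sines
   cancel. *)
have low k : (k <= m.+1)%N ->
    2 * sin a * (\sum_(j < k) `|cos (a *+ j.*2)|) = sin (a *+ k.*2 - a) + sin a.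
  elim: k => [_|k IHk km].
    by rewrite big_ord0 mulr0 double0 mulr0n sub0r -RoppE sin_neg RoppE addNr.
  rewrite big_ord_recr mulrDr IHk 1?ltnW //= ger0_norm; last first.
    apply/RleP/cos_ge_0; apply/RleP; rewrite -half_PI.
      apply: (@le_trans _ _ 0); last by rewrite mulrn_wge0 // ltW.
      by rewrite oppr_le0 divr_ge0 // ltW.
    by rewrite -[leRHS]aPI ler_wpMn2l ?ltW //; lia.
  rewrite stepE doubleS [a *+ _.+2]mulrSr addrK; ring.
(* Here the telescoping runs with the opposite sign; the constant 2 is twice the sine of [PI / 2].
   At [k = m] the last angle is [PI - a], so the two copies of [sin a] cancel. *)
have high k : (k <= m)%N ->
    2 * sin a * (\sum_(j < m.+1 + k) `|cos (a *+ j.*2)|)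
      = 2 + sin a - sin (a *+ (m.+1 + k).*2 - a).
  elim: k => [_|k IHk km].
    rewrite addn0 low // doubleS [a *+ _.+2]mulrSr addrK aPI half; ring.
  rewrite addnS big_ord_recr mulrDr IHk 1?ltnW //= ler0_norm; last first.
    apply/RleP/cos_le0; apply/RleP; rewrite -?half_PI.
      by rewrite -[leLHS]aPI ler_wpMn2l ?ltW //; lia.
    by rewrite -PIE ler_wpMn2l ?ltW //; lia.
  rewrite mulrN stepE doubleS [a *+ _.+2]mulrSr addrK; ring.
have -> : m.*2.+1 = (m.+1 + m)%N by rewrite -addnn addSn.
have := high m (leqnn _).
have -> : (m.+1 + m).*2 = m.*2.+1.*2 by rewrite addSn addnn.
rewrite PIE [sin (PI - a)]sin_PI_x addrK => H; lra.
Qed.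

Lemma sum_norm_cos_cosec (p : nat) : odd p ->
  \sum_(j <- iota 0 p) `|cos (PI / p%:R *+ j)| = cosec p%:R :> Rt.
Proof.
move=> op; have p0 : (p%:R : Rt) != 0 by rewrite pnatr_eq0; case: (p) op.
pose a : Rt := PI / 2 / p%:R.
have pE : p = (p./2).*2.+1 by rewrite -[LHS]odd_double_half op.
have ap : a *+ p = PI / 2 by rewrite -[LHS]mulr_natr divfK.
have := @sum_norm_cos p./2 a; rewrite -pE => /(_ ap) sumE.
(* The identity itself gives this: a product equal to 1 has no zero factor. *)
have a0 : sin a != 0 by apply: contra_eq_neq sumE => ->; rewrite mul0r eq_sym oner_neq0.
rewrite /cosec RdivE -half_PI RinvE; apply: (mulfI a0).
rewrite divff // -[RHS]sumE; congr (_ * _).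
rewrite -[p in iota 0 p]subn0 -/(index_iota 0 p) big_mkord.
apply: eq_bigr => j _; congr `|cos _|.
by rewrite -muln2 mulnC mulrnA mulr2n -mulrDl -splitr.
Qed.

(** The embedded eigenvalues and the explicit roots both split the image of the same integer
    polynomial, so they agree up to order; the zero eigenvalues add nothing. *)
Lemma Re_embC_energy (n : nat) (A : 'M[int]_n) (p q : nat) :
  two_cycles A p q -> odd p -> odd q ->
  complex.Re (embC Rt (energy A)) = cosec p%:R + cosec q%:R.
Proof.
move=> tA op oq; have [_ _ _ [e1 [e2 [E1 E2 cpE]]]] := two_cycles_char_poly tA op oq.
have esE : \prod_(z <- eigenvalues A) ('X - z%:P) = map_poly intr (char_poly A) :> {poly algC}.
  rewrite /eigenvalues; case: closed_field_poly_normal => s /= sE.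
  by move: sE; rewrite (monicP (char_poly_monic _)) scale1r -map_char_poly.
have perm_es : perm_eq (map (embC Rt) (eigenvalues A))
   (nseq (n - p - q) 0 ++ [seq odd_root e1 p j | j <- iota 0 p]
     ++ [seq odd_root e2 q j | j <- iota 0 q]).
  apply: prod_XsubC_eq; rewrite !big_cat /= -!Xn_sub_pm1_factor //.
  rewrite big_nseq subr0 iter_mulr_1 mulrA.
  transitivity (map_poly intr (char_poly A) : {poly Rt[i]}).
    rewrite big_map -(eq_bigr _ (fun z _ => map_polyXsubC (embC Rt) z)) -rmorph_prod /= esE.
    by rewrite -map_poly_comp; apply: eq_map_poly => z /=; rewrite rmorph_int.
  by rewrite cpE !rmorphM !rmorphB /= !map_polyXn !map_polyC.
have ReD : {morph (@complex.Re Rt) : x y / x + y} by case=> ? ? [].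
rewrite /energy rmorph_sum /= (big_morph _ ReD (erefl _)).
under eq_bigr do rewrite Re_embC_norm_Re.
rewrite -(big_map (embC Rt) xpredT (fun w => `|complex.Re w|)) (perm_big _ perm_es) /=.
rewrite !big_cat /= big_nseq normr0 iter_addr_0 mul0rn add0r !big_map.
rewrite -!sum_norm_cos_cosec //.
by congr (_ + _); apply: eq_bigr => j _; apply: norm_Re_odd_root.
Qed.

(** * Sidigraphs with prescribed cycle lengths *)

Section Existence.

Context (n p q : nat).
Hypotheses (p1 : (1 < p)%N) (q1 : (1 < q)%N) (pqn : (p + q <= n)%N).

Definition chain_arc (i j : nat) : bool :=
  [|| j == i.+1, (i.+1 == p) && (j == 0%N) | (i.+1 == p + q)%N && (j == p)].

Definition chain_mx : 'M[int]_n := \matrix_(i, j) (chain_arc i j)%:R.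

(** Follows the cycle arcs instead of the path at the end of each block and fixes the tail, so that
    it is injective and its nontrivial orbits are the two cycles. *)
Definition chain_succ (i : nat) : nat :=
  if i.+1 == p then 0%N else if i.+1 == (p + q)%N then p
  else if (i < p + q)%N then i.+1 else i.

Lemma chain_succ_ltn (i : 'I_n) : (chain_succ i < n)%N.
Proof. by have := ltn_ord i; rewrite /chain_succ; do 3?case: ifP; lia. Qed.

Definition chain_next (i : 'I_n) : 'I_n := Ordinal (chain_succ_ltn i).

Lemma chain_next_inj : injective chain_next.
Proof.
move=> i j /(congr1 val) /=; rewrite /chain_succ => E; apply: val_inj => /=.
by move: E; do 6?case: ifP; lia.
Qed.

Lemma arc_chain_mx (i j : 'I_n) : Defs.arc chain_mx i j = chain_arc i j.
Proof. by rewrite /Defs.arc mxE; case: chain_arc. Qed.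

Lemma chain_mx_next (i : 'I_n) : (i < p + q)%N -> chain_mx i (chain_next i) = 1.
Proof.
move=> ipq; rewrite mxE /= (_ : chain_arc _ _ = true) //.
by rewrite /chain_arc /chain_succ; do 3?case: ifP; lia.
Qed.

(** Iteration from [a] climbs through the block one vertex at a time, and only the last vertex jumps
    back to [a]. *)
Lemma chain_block (a l : nat) (x : 'I_n) : (0 < l)%N -> (a + l <= p + q)%N -> val x = a ->
  (forall i, (a <= i < a + l)%N -> chain_succ i = if i.+1 == (a + l)%N then a else i.+1) ->
  orbit chain_next x =i [pred i : 'I_n | a <= i < a + l]%N.
Proof.
move=> l0 al xa succE i; rewrite inE; apply/idP/idP.
  rewrite -fconnect_orbit => /iter_findex <-.
  elim: (findex _ _ _) => [|k IHk] /=; first by rewrite xa leqnn -[X in (X < _)%N]addn0 ltn_add2l.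
  by rewrite succE //; case: ifP => {xa succE}; move: (nat_of_ord _) IHk => j; lia.
move=> /andP[ai ial].
have iterE k : (k < l)%N -> val (iter k chain_next x) = (a + k)%N.
  elim: k => [|k IHk] kl; first by rewrite addn0.
  have /= iterk := IHk (ltnW kl).
  have in_block : (a <= a + k < a + l)%N by rewrite leq_addr ltn_add2l ltnW.
  rewrite /= iterk succE //; case: eqP => [/eqP|_]; last by rewrite addnS.
  rewrite -addnS eqn_add2l => /eqP kl'.
  by rewrite kl' ltnn in kl.
have -> : i = iter (i - a) chain_next x by apply: val_inj; rewrite /= iterE ?subnKC // ltn_subLR.
by rewrite -fconnect_orbit fconnect_iter.
Qed.

Lemma size_chain_block (a l : nat) (x : 'I_n) : (a + l <= p + q)%N ->
  orbit chain_next x =i [pred i : 'I_n | a <= i < a + l]%N ->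
  size (orbit chain_next x) = l.
Proof.
move=> al orbE; rewrite -(size_map val) -[RHS](size_iota a); apply: perm_size.
apply: uniq_perm; rewrite ?iota_uniq ?(map_inj_uniq val_inj) ?orbit_uniq // => k.
rewrite mem_iota; apply/mapP/idP => [[i + ->]|kal]; first by rewrite orbE inE.
have kn : (k < n)%N by lia.
by exists (Ordinal kn); rewrite // orbE inE.
Qed.

Definition orbit_arcs (x : 'I_n) : {set 'I_n * 'I_n} :=
  [set e | (e.1 \in orbit chain_next x) && (e.2 == chain_next e.1)].

Lemma orbit_arcsE (x i j : 'I_n) :
  ((i, j) \in orbit_arcs x)
    = (i \in orbit chain_next x) && (j == next (orbit chain_next x) i).
Proof.
rewrite inE /=; case io: (i \in _) => //=.
by rewrite (nextE (cycle_orbit chain_next_inj x) io).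
Qed.

Lemma orbit_arcs_dcycle (x : 'I_n) : (1 < size (orbit chain_next x))%N ->
  {in orbit chain_next x, forall i : 'I_n, (i < p + q)%N} ->
  is_dcycle chain_mx (orbit_arcs x) /\ cycle_sign chain_mx (orbit_arcs x) = 1.
Proof.
move=> sz lt_pq; split.
  apply/dcycleP; exists (orbit chain_next x); split=> //; first exact: orbit_uniq.
    move=> i io; rewrite (nextE (cycle_orbit chain_next_inj x) io).
    by rewrite /Defs.arc chain_mx_next ?lt_pq.
  exact: orbit_arcsE.
rewrite (cycle_signE _ (orbit_arcsE x)) big1 // => i io.
by rewrite (nextE (cycle_orbit chain_next_inj x) io) chain_mx_next ?lt_pq.
Qed.

(* The block index is monotone along arcs, hence constant on a directed cycle. *)
Lemma chain_cycle_next (c : seq 'I_n) (x : 'I_n) : uniq c ->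
  {in c, forall i, Defs.arc chain_mx i (next c i)} -> x \in c ->
  (x < p + q)%N /\ next c x = chain_next x.
Proof.
move=> Uc arcs xc.
(* Each vertex of the tail is a block of its own, so no arc stays inside a block there. *)
pose b (i : nat) := if (i < p)%N then 0%N else if (i < p + q)%N then 1%N else i.
have le_b i : i \in c -> (b i <= b (next c i) ?= iff (b i == b (next c i)))%N.
  move=> ic; split=> //; have := arcs i ic; rewrite arc_chain_mx /chain_arc /b.
  by do 4?case: ifP; lia.
(* [next c] permutes [c], so the sums agree and every inequality of [le_b] is an equality. *)
have sumE : (\sum_(i in c) b i = \sum_(i in c) b (next c i))%N.
  rewrite [LHS](reindex_inj (can_inj (prev_next Uc))) /=.
  by apply: eq_bigl => i; rewrite mem_next.
have [_] := leqif_sum le_b; rewrite sumE eqxx => /esym/forall_inP/(_ x xc).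
have := arcs x xc; rewrite arc_chain_mx.
(* Within one block, the only arc leaving a vertex is the one to its [chain_succ]. *)
suff H (i j : nat) : chain_arc i j -> b i == b j -> (i < p + q)%N /\ j = chain_succ i.
  by move=> /H{}H /H[? ?]; split=> //; apply: val_inj.
by rewrite /chain_arc /b /chain_succ; do 7?case: ifP; lia.
Qed.

(** Every directed cycle is a cycle of the injective map [chain_next], hence the whole orbit of any
    of its vertices. *)
Lemma chain_cycle_unique (c : seq 'I_n) (x y : 'I_n) : uniq c ->
  {in c, forall i, Defs.arc chain_mx i (next c i)} -> y \in c ->
  y \in orbit chain_next x -> c =i orbit chain_next x.
Proof.
move=> Uc arcs yc yx.
have cyc : fcycle chain_next c.
  by apply: cycle_from_next => // i /(chain_cycle_next Uc arcs)[_ ->] /=.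
have cycx := cycle_orbit chain_next_inj x.
move=> i; rewrite -(mem_rot (index y c)) -(orbitE cyc Uc yc).
by rewrite (orbitE cycx (orbit_uniq _ _) yx) mem_rot.
Qed.

Lemma is_Dnpq_chain_mx : is_Dnpq chain_mx p q.
Proof.
have n0 : (0 < n)%N by lia.
have pn : (p < n)%N by lia.
pose x0 := Ordinal n0; pose xp := Ordinal pn.
have orb0 : orbit chain_next x0 =i [pred i : 'I_n | 0 <= i < 0 + p]%N.
  apply: chain_block; rewrite ?leq_addr //; first by lia.
  by move=> i; rewrite /chain_succ; do 4?case: ifP; lia.
have orbp : orbit chain_next xp =i [pred i : 'I_n | p <= i < p + q]%N.
  apply: chain_block => //; first by lia.
  by move=> i; rewrite /chain_succ; do 4?case: ifP; lia.
have sz0 : size (orbit chain_next x0) = p by apply: size_chain_block orb0; rewrite leq_addr.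
have szp : size (orbit chain_next xp) = q by apply: size_chain_block orbp.
have [dC1 s1] : is_dcycle chain_mx (orbit_arcs x0) /\ cycle_sign chain_mx (orbit_arcs x0) = 1.
  by apply: orbit_arcs_dcycle => [|i]; rewrite ?sz0 // orb0 inE; lia.
have [dC2 s2] : is_dcycle chain_mx (orbit_arcs xp) /\ cycle_sign chain_mx (orbit_arcs xp) = 1.
  by apply: orbit_arcs_dcycle => [|i]; rewrite ?szp // orbp inE; lia.
split; last split.
- split=> [i j|i]; rewrite mxE; first by case: chain_arc.
  by rewrite (_ : chain_arc i i = false) // /chain_arc; lia.
(* The path arcs join every vertex to vertex 0. *)
- pose r := [rel x y : 'I_n | Defs.arc chain_mx x y || Defs.arc chain_mx y x].
  have symr : connect_sym r by apply: sym_connect_sym => i j /=; rewrite orbC.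
  suff H i : connect r x0 i by move=> i j; apply: connect_trans (H j); rewrite symr.
  case: i => i; elim: i => [|i IHi] lt_in.
    by rewrite (_ : x0 = Ordinal lt_in) //; apply: val_inj.
  apply: connect_trans (IHi (ltnW lt_in)) (connect1 _).
  by rewrite /= !arc_chain_mx /chain_arc /= eqxx.
exists (orbit_arcs x0), (orbit_arcs xp); split=> //.
- rewrite disjoint_subset; apply/fintype.subsetP => i.
  rewrite (cycle_vertsE (orbit_arcsE x0)) orb0 !inE (cycle_vertsE (orbit_arcsE xp)) orbp inE.
  by lia.
- move=> C /dcycleP[c [Uc szc arcs CE]].
  have [y yc] : exists y, y \in c.
    by case: c szc {Uc arcs CE} => // y s _; exists y; rewrite inE eqxx.
  have [y_pq _] := chain_cycle_next Uc arcs yc.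
  have CE' x : c =i orbit chain_next x -> C = orbit_arcs x.
    move=> cx; apply/setP => -[i j]; rewrite CE inE /= -cx.
    by case ic: (i \in c) => //=; rewrite (chain_cycle_next Uc arcs ic).2.
  have [y_p|p_y] := ltnP y p; [left | right]; apply/CE'/(chain_cycle_unique Uc arcs yc).
    by rewrite orb0.
  by rewrite orbp inE p_y.
split=> //; first by rewrite (cycle_lenE (orbit_uniq _ _) (orbit_arcsE x0)).
by rewrite (cycle_lenE (orbit_uniq _ _) (orbit_arcsE xp)).
Qed.

End Existence.

(** * Comparison of energies and the extremal cases *)

Lemma is_Dnpq_two_cycles (n : nat) (A : 'M[int]_n) (p q : nat) :
  is_Dnpq A p q -> two_cycles A p q.
Proof.
move=> [sA [cA [C1 [C2 [dC1 dC2 dis only [len1 len2 _ _]]]]]].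
by split=> //; split=> //; exists C1, C2.
Qed.

Lemma energy_real (n : nat) (A : 'M[int]_n) : energy A \is Num.real.
Proof. by apply: rpred_sum => z _; apply: normr_real. Qed.

Lemma energy_le (n : nat) (A B : 'M[int]_n) (p q p' q' : nat) :
  two_cycles A p q -> odd p -> odd q -> two_cycles B p' q' -> odd p' -> odd q' ->
  cosec p%:R + cosec q%:R <= cosec p'%:R + cosec q'%:R :> Rt ->
  energy A <= energy B.
Proof.
move=> tA op oq tB op' oq' le_cosec.
rewrite -(Re_embC_le Rt (energy_real A) (energy_real B)).
by rewrite (Re_embC_energy tA op oq) (Re_embC_energy tB op' oq').
Qed.

Lemma cosec_nat_le (p q : nat) : (0 < p)%N -> (p <= q)%N ->
  cosec p%:R <= cosec q%:R :> Rt.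
Proof.
move=> p0 pq; apply/RleP/cosec_le; apply/RleP; last by rewrite ler_nat.
by rewrite -[IZR 1]/(1%:R : Rt) ler_nat.
Qed.

Lemma cosec_nat_spread (a p q : nat) : (0 < a)%N -> (a <= p)%N -> (a <= q)%N ->
  cosec p%:R + cosec q%:R <= cosec a%:R + cosec (p + q - a)%:R :> Rt.
Proof.
move=> a0 ap aq; rewrite natrB ?natrD; last by rewrite (leq_trans ap) ?leq_addr.
apply/RleP/cosec_spread; apply/RleP; rewrite ?ler_nat //.
by rewrite -[IZR 1]/(1%:R : Rt) ler_nat.
Qed.

(** Convexity first spreads the lengths to 3 and [p + q - 3]; monotonicity then replaces the latter
    by [r]. Both maximal cases are instances. *)
Lemma odd_Dns_energy_le (n : nat) (T S : 'M[int]_n) (r : nat) :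
  odd r -> is_Dnpq T 3 r -> odd_Dns S ->
  (forall p q, odd p -> odd q -> (p + q <= n)%N -> (p + q <= 3 + r)%N) ->
  energy S <= energy T.
Proof.
move=> r_odd /is_Dnpq_two_cycles tT [p [q [tS op oq]]] bound.
have [p1 q1 pqn _] := two_cycles_char_poly tS op oq.
have le_r := bound p q op oq pqn.
apply: (energy_le tS op oq tT) => //.
have p3 : (3 <= p)%N by case: (p) p1 op => [|[|[|]]].
have q3 : (3 <= q)%N by case: (q) q1 oq => [|[|[|]]].
apply: (le_trans (cosec_nat_spread (isT : (0 < 3)%N) p3 q3)).
by rewrite lerD2l cosec_nat_le; lia.
Qed.

Unset Implicit Arguments.

Theorem theorem3p19 (n : nat) (Hn : (5 < n)%N) :
  (~~ odd n ->
     (exists T : 'M[int]_n, is_Dnpq T 3 (n - 3)) /\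
     (forall T S : 'M[int]_n, is_Dnpq T 3 (n - 3) -> odd_Dns S ->
        energy S <= energy T)) /\
  (odd n ->
     (exists T : 'M[int]_n, is_Dnpq T 3 (n - 4)) /\
     (forall T S : 'M[int]_n, is_Dnpq T 3 (n - 4) -> odd_Dns S ->
        energy S <= energy T)) /\
  ((exists T : 'M[int]_n, is_Dnpq T 3 3) /\
   (forall T S : 'M[int]_n, is_Dnpq T 3 3 -> odd_Dns S ->
      energy T <= energy S)).
Proof.
split=> [n_even|].
  split=> [|T S tT oS]; first by exists (chain_mx n 3 (n - 3)); apply: is_Dnpq_chain_mx; lia.
  by apply: odd_Dns_energy_le tT oS _; lia.
split=> [n_odd|].
  split=> [|T S tT oS]; first by exists (chain_mx n 3 (n - 4)); apply: is_Dnpq_chain_mx; lia.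
  (* A sum of two odd lengths is even, so for odd [n] it is at most [n - 1], that is
     [3 + (n - 4)]. *)
  by apply: odd_Dns_energy_le tT oS _; lia.
split=> [|T S /is_Dnpq_two_cycles tT [p [q [tS op oq]]]].
  by exists (chain_mx n 3 3); apply: is_Dnpq_chain_mx; lia.
have [p1 q1 _ _] := two_cycles_char_poly tS op oq.
apply: (energy_le tT _ _ tS) => //.
(* Odd lengths above 1 are at least 3, and [cosec] is increasing. *)
by rewrite lerD // cosec_nat_le //; lia.
Qed.
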